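(* Let $F$ be a field of characteristic $\ell\neq 2$, let $V$ be a non-zero finite dimensional vector space over $F$, and let $f:V\times V\to F$ be a non-degenerate bilinear form with asymmetry $\sigma$ such that $\sigma+1_V$ is nilpotent. Then $L(f)$ is absolutely reductive if and only if $\sigma$ is cyclic, in which case $L(f)$ is abelian, or $\sigma=-1_V$, in which case $f$ is skew-symmetric.
   Context: $L(f)=\{x\in\mathfrak{gl}(V)\mid f(xv,w)=-f(v,xw)\ \text{for all } v,w\in V\}$. The asymmetry $\sigma\in\mathrm{GL}(V)$ of the non-degenerate form $f$ is defined by $f(w,v)=f(v,\sigma w)$ for all $v,w\in V$. An operator is cyclic if its minimal and characteristic polynomials coincide. A Lie algebra is reductive if every solvable ideal is central; a Lie algebra over $F$ is absolutely reductive if it is reductive and stays reductive after extending scalars to an algebraic closure of $F$. *)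

(* Defs.v *)
From HB Require Import structures.
From mathcomp Require Import all_boot all_order all_algebra.
Set Implicit Arguments.
Unset Strict Implicit.
Unset Printing Implicit Defensive.
Import GRing.Theory.
Local Open Scope ring_scope.

(* A finite dimensional Lie algebra is given by a bracket br on a vectType T
   and a subspace L of T closed under br. *)
Section LieAlgebra.
Variables (F : fieldType) (T : vectType F) (br : T -> T -> T).
Implicit Types L I J : {vspace T}.

Definition lie_abelian L : Prop :=
  forall x y, x \in L -> y \in L -> br x y = 0.

Definition lie_ideal L I : Prop :=
  (I <= L)%VS /\ forall x y, x \in L -> y \in I -> br x y \in I.

Definition lie_central L I : Prop :=
  forall x y, x \in L -> y \in I -> br x y = 0.

(* For bilinear br, this is the span of all br x y with x \in I and y \in J. *)
Definition lie_prod I J : {vspace T} :=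
  <<[seq br x y | x <- vbasis I, y <- vbasis J]>>%VS.

Definition lie_derived (n : nat) I : {vspace T} :=
  iter n (fun J => lie_prod J J) I.

Definition lie_solvable I : Prop := exists n, lie_derived n I = 0%VS.

Definition lie_reductive L : Prop :=
  forall I, lie_ideal L I -> lie_solvable I -> lie_central L I.

(* The bracket of the Lie algebra obtained from L by extension of scalars along
   iota. Its underlying space is written in the K-basis 1 (x) b_i, where (b_i) is
   the F-basis vbasis L of L; this basis has the structure constants of L. *)
Definition lie_ext_bracket (K : fieldType) (iota : {rmorphism F -> K}) L
    (u v : 'rV[K]_(\dim L)) : 'rV[K]_(\dim L) :=
  \row_k \sum_i \sum_j u 0 i * v 0 j
    * iota (coord (vbasis L) k (br (vbasis L)`_i (vbasis L)`_j)).

End LieAlgebra.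

Definition lie_absolutely_reductive (F : fieldType) (T : vectType F)
    (br : T -> T -> T) (L : {vspace T}) : Prop :=
  lie_reductive br L /\
  forall (K : closedFieldType) (iota : {rmorphism F -> K}),
    (forall a : K, algebraicOver iota a) ->
    lie_reductive (@lie_ext_bracket F T br K iota L) fullv.

Section Endomorphisms.
Variables (F : fieldType) (V : vectType F).
Implicit Types x y : 'End(V).

Definition lfun_bracket x y : 'End(V) := (x \o y)%VF - (y \o x)%VF.

Lemma lfun_bracketE x y u : lfun_bracket x y u = x (y u) - y (x u).
Proof. by rewrite /lfun_bracket add_lfunE opp_lfunE !comp_lfunE. Qed.

Definition nilpotent_lfun x : Prop := exists k, forall v : V, iter k x v = 0.

(* mxminpoly expects a size of the form n.+1; for V non-zero, conform_mx only
   casts along \dim {:V} = (\dim {:V}).-1.+1. *)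
Definition lfun_mx x : 'M[F]_((\dim {:V}).-1.+1) :=
  conform_mx 0 (passmx.mxof (vbasis {:V}) (vbasis {:V}) x).

Definition cyclic_lfun x : Prop :=
  mxminpoly (lfun_mx x) = char_poly (lfun_mx x).

Variable f : {biscalar V}.

Definition nondegenerate_form : Prop :=
  (forall v, (forall w, f v w = 0) -> v = 0) /\
  (forall w, (forall v, f v w = 0) -> w = 0).

Definition skew_symmetric_form : Prop := forall v w, f v w = - f w v.

Definition is_asymmetry (sigma : 'End(V)) : Prop :=
  lker sigma = 0%VS /\ forall v w, f w v = f v (sigma w).

Definition skew_defect x : 'M[F]_(\dim {:V}) :=
  \matrix_(i, j) (f (x (vbasis {:V})`_i) (vbasis {:V})`_j
                  + f (vbasis {:V})`_i (x (vbasis {:V})`_j)).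

Fact skew_defect_linear : linear skew_defect.
Proof.
move=> a x y; apply/matrixP => i j; rewrite !mxE !lfunE /= !lfunE /=.
by rewrite linearPl linearPr /= mulrDr addrACA.
Qed.
HB.instance Definition _ := GRing.isSemilinear.Build F _ _ _ skew_defect
  (GRing.semilinear_linear skew_defect_linear).

Definition lie_of_form : {vspace 'End(V)} := lker (linfun skew_defect).

Lemma lie_of_formP x :
  reflect (forall v w, f (x v) w = - f v (x w)) (x \in lie_of_form).
Proof.
rewrite memv_ker lfunE /=; apply: (iffP eqP) => [x0 v w|fx]; last first.
  by apply/matrixP => i j; rewrite !mxE fx addNr.
have fxb (i j : 'I_(\dim {:V})) : f (x (vbasis {:V})`_i) (vbasis {:V})`_j
    = - f (vbasis {:V})`_i (x (vbasis {:V})`_j).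
  by apply/eqP; rewrite -addr_eq0; move/matrixP/(_ i j): x0; rewrite !mxE => ->.
rewrite (coord_vbasis (memvf v)) linear_sum !linear_sumlz -sumrN.
apply: eq_bigr => i _; rewrite linearZ /= !linearZl_LR -mulrN; congr (_ * _).
rewrite (coord_vbasis (memvf w)) !linear_sum -sumrN; apply: eq_bigr => j _.
by rewrite !linearZ /= fxb mulrN.
Qed.

Lemma lie_of_form_bracket x y : x \in lie_of_form -> y \in lie_of_form ->
  lfun_bracket x y \in lie_of_form.
Proof.
move=> /lie_of_formP fx /lie_of_formP fy; apply/lie_of_formP => v w.
by rewrite !lfun_bracketE linearBl linearBr !(fx, fy) !opprK opprB.
Qed.
End Endomorphisms.

(* Main.v *)
From HB Require Import structures.
Require Import Defs.
From mathcomp Require Import all_boot all_order all_algebra.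
From mathcomp Require Import ring zify.
Import GRing.Theory.
Local Open Scope ring_scope.

(** Let G be the matrix of f, S that of sigma, and N = S + 1, which is
    nilpotent; let n = dim V. Everything happens in matrices: a Lie algebra
    with a faithful representation (faithful_rep) inherits the calculus of
    commutators, and both L(f) and its extensions of scalars have one.

    The relation G^T = G S makes the skew part Om = G - G^T = G (2 - N)
    invertible, as 2 is not an eigenvalue of N. Write G + G^T = Om t. Then t
    is a nilpotent element of the symplectic Lie algebra sp(Om), and L(f) is
    the centraliser of t in sp(Om) (skew_for_centraliser). Moreover t^k = 0 if
    and only if N^k = 0. So sigma = -1 means t = 0, and sigma is cyclic if and
    only if t^(n - 1) is not zero (cyclic_mxE).

    If sigma is cyclic, L(f) lies in the centraliser of sigma, which is
    commutative (cyclic_nilpotent_comm), and an abelian algebra stays abelian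
    over every extension field K of F.

    If sigma = -1, then f is skew and L(f) = sp(f). Over any field of
    characteristic not 2, sp has no non-zero abelian ideal, by one identity
    involving the elements v |-> f(u, v) u (symplectic_reductive). Hence it
    has no non-zero solvable ideal. Over K the same argument applies, because
    the image of the extended representation still contains these elements
    (ext_rep_outer).

    If t is neither zero nor regular, L(f) fails to be reductive over F
    itself. Let k be the nilpotency index of t, so 2 <= k < n, and let
    q = t^(k - 1); write (v, w) for the form Om. The elements of L(f) with
    image in ker t that map ker t to im t form a solvable ideal (nil_ideal). It
    contains the maps v |-> (q e, v) w + (w, v) q e with w in ker t, and L(f)
    contains averages over powers of t of arbitrary rank one maps, symmetrised according to the parity of k
    (centraliser_elt). Some explicit pair of these does not commute. If some
    (e, q e) is not zero, the pair uses a vector w in ker t orthogonal to e,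
    which exists since k < n (reductive_exp_alt_even). Otherwise (_, q _) is
    alternating, and the pair is built from two vectors on which it does not
    vanish (nilpotent_centraliser_not_reductive). *)

Set Implicit Arguments.
Unset Strict Implicit.
Unset Printing Implicit Defensive.

(** * Lie algebras with a faithful matrix representation *)

Section FaithfulRepresentation.
Variables (F : fieldType) (T : vectType F) (br : T -> T -> T).
Variables (L : {vspace T}) (n : nat) (Phi : {linear T -> 'M[F]_n}).

(** Nothing is known about br outside L; injectivity on L is what transports
    bilinearity, antisymmetry and the Jacobi identity from commutators of
    matrices to br. *)
Definition faithful_rep : Prop :=
  [/\ forall x y, x \in L -> y \in L -> br x y \in L,
      forall x y, x \in L -> y \in L ->
        Phi (br x y) = Phi x *m Phi y - Phi y *m Phi x &
      forall x, x \in L -> Phi x = 0 -> x = 0].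

Lemma lie_prod_sub (I J U : {vspace T}) :
  (forall x y, x \in I -> y \in J -> br x y \in U) ->
  (lie_prod br I J <= U)%VS.
Proof.
move=> brU; apply/span_subvP => _ /allpairsP[[x y] /= [xI yJ ->]].
by apply: brU; apply: vbasis_mem.
Qed.

Hypothesis repL : faithful_rep.

Lemma rep_inj x y : x \in L -> y \in L -> Phi x = Phi y -> x = y.
Proof.
case: repL => _ _ Phi0 xL yL Exy; apply/eqP; rewrite -subr_eq0; apply/eqP.
by apply: Phi0; rewrite ?rpredB // linearB /= Exy subrr.
Qed.

Lemma rep_brN x y : x \in L -> y \in L -> br x y = - br y x.
Proof.
case: repL => brL Phibr _ xL yL; apply: rep_inj; rewrite ?rpredN ?brL //.
by rewrite linearN /= !Phibr // opprB.
Qed.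

Lemma rep_jacobi x y z : x \in L -> y \in L -> z \in L ->
  br x (br y z) = br (br x y) z + br y (br x z).
Proof.
case: repL => brL Phibr _ xL yL zL.
apply: rep_inj; rewrite ?rpredD ?brL //.
rewrite linearD /= !(Phibr, brL) // !mulmxBl !mulmxBr !mulmxA.
set a := Phi x *m Phi y *m Phi z; set b := Phi x *m Phi z *m Phi y.
set c := Phi y *m Phi z *m Phi x; set d := Phi z *m Phi y *m Phi x.
set e := Phi y *m Phi x *m Phi z; set g := Phi z *m Phi x *m Phi y.
rewrite !opprB; move: a b c d e g => a b c d e g.
by apply/matrixP => i j; rewrite !mxE; ring.
Qed.

(** As br x is not a linear map on T, the argument goes through coordinates:
    the expansion of br x y along s holds because Phi is linear and injective
    on L. *)
Lemma rep_br_span x (s : seq T) (U : {vspace T}) y : x \in L ->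
  {subset s <= L} -> (forall z, z \in s -> br x z \in U) ->
  y \in <<s>>%VS -> br x y \in U.
Proof.
case: repL => brL Phibr _ xL sL sU ys.
have sLi (i : 'I_(size s)) : s`_i \in L by apply/sL/mem_nth.
have -> : br x y = \sum_i coord (in_tuple s) i y *: br x s`_i.
  apply: rep_inj.
  - by apply: brL => //; apply: subvP ys; apply/span_subvP.
  - by apply: rpred_sum => i _; rewrite rpredZ ?brL.
  rewrite Phibr //; last by apply: subvP ys; apply/span_subvP.
  rewrite linear_sum /= {1 2}(@coord_span _ _ _ (in_tuple s) _ ys).
  rewrite linear_sum /= mulmx_sumr mulmx_suml.
  rewrite -sumrB; apply: eq_bigr => i _.
  by rewrite !linearZ /= Phibr // scalerBr -?scalemxAr -?scalemxAl.
by apply: rpred_sum => i _; rewrite rpredZ ?sU ?mem_nth.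
Qed.

Lemma rep_mem_lie_prod (I J : {vspace T}) x y :
  (I <= L)%VS -> (J <= L)%VS -> x \in I -> y \in J ->
  br x y \in lie_prod br I J.
Proof.
move=> /subvP IL /subvP JL xI yJ.
have basL (K : {vspace T}) : {subset K <= L} -> {subset vbasis K <= L}.
  by move=> KL z /vbasis_mem/KL.
apply: (@rep_br_span _ (vbasis J)); rewrite ?(span_basis (vbasisP J)) //.
- exact: IL.
- exact: basL.
move=> z zJ; have zL : z \in L by exact: basL zJ.
rewrite (rep_brN (IL _ xI) zL) rpredN.
apply: (@rep_br_span _ (vbasis I)); rewrite ?(span_basis (vbasisP I)) //.
  exact: basL.
move=> w wI; rewrite (rep_brN zL (basL _ IL _ wI)) rpredN.
by apply/memv_span/allpairsP; exists (w, z).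
Qed.

(** The Jacobi identity makes ad x a derivation. *)
Lemma lie_ideal_prod I : lie_ideal br L I -> lie_ideal br L (lie_prod br I I).
Proof.
case: repL => brL _ _ [IL Iid]; have /subvP IL' := IL.
split=> [|x y xL].
  apply: subv_trans IL; apply: lie_prod_sub => a b aI bI.
  by apply: Iid; rewrite ?IL'.
apply: rep_br_span => //.
  move=> _ /allpairsP[[a b] /= [/vbasis_mem/IL' aL /vbasis_mem/IL' bL ->]].
  exact: brL.
move=> _ /allpairsP[[a b] /= [/vbasis_mem aI /vbasis_mem bI ->]].
have aL := IL' _ aI; have bL := IL' _ bI; rewrite rep_jacobi //.
by rewrite rpredD // rep_mem_lie_prod ?Iid.
Qed.

(** The last non-zero term of the derived series of a solvable ideal is an
    abelian ideal; hence, without non-zero abelian ideals, every solvable ideal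
    is zero. *)
Lemma lie_reductive_no_abelian_ideal :
  (forall I, lie_ideal br L I -> lie_abelian br I -> I = 0%VS) ->
  lie_reductive br L.
Proof.
move=> abel0.
have solv0 k I : lie_ideal br L I -> lie_derived br k I = 0%VS -> I = 0%VS.
  elim: k I => // k IHk I Iid; rewrite /lie_derived iterSr => /IHk I0.
  apply: abel0 => // x y xI yI; apply/eqP; rewrite -memv0.
  have /I0 <- := lie_ideal_prod Iid.
  by case: Iid => IL _; apply: rep_mem_lie_prod.
move=> I Iid [k Ik] x y xL; rewrite (solv0 k I Iid Ik) memv0 => /eqP ->.
case: repL => brL Phibr Phi0; apply: Phi0; rewrite ?brL ?rpred0 //.
by rewrite Phibr ?rpred0 // linear0 mulmx0 mul0mx subrr.
Qed.

End FaithfulRepresentation.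

(** * Bilinear forms given by a matrix *)

Section BilinearForms.
Variables (F : fieldType) (n : nat).
Implicit Types (G X Y : 'M[F]_n) (u v w : 'cV[F]_n).

Definition mxform G u v : F := (u^T *m G *m v) 0 0.

Lemma mxformE G u v : u^T *m G *m v = (mxform G u v)%:M.
Proof. exact: mx11_scalar. Qed.

Lemma outerE w u G v : w *m u^T *m G *m v = mxform G u v *: w.
Proof. by rewrite -mul_mx_scalar -mxformE !mulmxA. Qed.

Lemma mxform_tr G u v : mxform G u v = mxform G^T v u.
Proof.
rewrite /mxform; have -> : u^T *m G *m v = (v^T *m G^T *m u)^T.
  by rewrite !trmx_mul !trmxK mulmxA.
by rewrite mxE.
Qed.

Lemma mxformN G u v : mxform (- G) u v = - mxform G u v.
Proof. by rewrite /mxform mulmxN mulNmx mxE. Qed.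

Lemma mxform_swap G u v : G^T = - G -> mxform G u v = - mxform G v u.
Proof. by move=> Gskew; rewrite mxform_tr Gskew mxformN. Qed.

Lemma mxformDl G u v w : mxform G (u + v) w = mxform G u w + mxform G v w.
Proof. by rewrite /mxform linearD /= !mulmxDl mxE. Qed.

Lemma mxformDr G u v w : mxform G u (v + w) = mxform G u v + mxform G u w.
Proof. by rewrite /mxform mulmxDr mxE. Qed.

Lemma mxformZl G a u v : mxform G (a *: u) v = a * mxform G u v.
Proof. by rewrite /mxform linearZ /= -!scalemxAl mxE. Qed.

Lemma mxformZr G a u v : mxform G u (a *: v) = a * mxform G u v.
Proof. by rewrite /mxform -scalemxAr mxE. Qed.

Lemma mxform0r G u : mxform G u 0 = 0.
Proof. by rewrite /mxform mulmx0 mxE. Qed.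

Lemma mxform_mulr G X u v : mxform G u (X *m v) = mxform (G *m X) u v.
Proof. by rewrite /mxform !mulmxA. Qed.

Lemma mxform_mull G X u v : mxform G (X *m u) v = mxform (X^T *m G) u v.
Proof. by rewrite /mxform trmx_mul !mulmxA. Qed.

Lemma mxform_delta G i j : mxform G (delta_mx i 0) (delta_mx j 0) = G i j.
Proof. by rewrite /mxform trmx_delta -rowE -colE !mxE. Qed.

Lemma mxform_alt_skew G : (forall u, mxform G u u = 0) -> G^T = - G.
Proof.
move=> G0; apply/matrixP => i j; rewrite !mxE; apply/eqP; rewrite -addr_eq0.
have := G0 (delta_mx i 0 + delta_mx j 0).
by rewrite mxformDl !mxformDr !G0 !mxform_delta add0r addr0 addrC => ->.
Qed.

Lemma mxform_skew_alt G u : (2 : F) != 0 -> G^T = - G -> mxform G u u = 0.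
Proof.
move=> two_neq0 Gskew; apply: (mulfI two_neq0); rewrite mulr0 mulr_natl mulr2n.
by rewrite {1}mxform_tr Gskew mxformN addNr.
Qed.

Lemma mx_double_eq0 m p (A : 'M[F]_(m, p)) : (2 : F) != 0 -> A = - A -> A = 0.
Proof.
move=> two_neq0 AN; apply/matrixP => i j; rewrite mxE.
apply: (mulfI two_neq0); rewrite mulr0 mulr_natl mulr2n.
by rewrite {1}AN mxE addNr.
Qed.

Lemma mxform_nondegenerate G v : G \in unitmx -> v != 0 ->
  exists w, mxform G w v != 0.
Proof.
move=> Gu v0; have : G *m v != 0.
  by apply: contraNneq v0 => Gv; rewrite -(mulKmx Gu v) Gv mulmx0.
case/matrix0Pn => i [j]; rewrite ord1 => Gvi; exists (delta_mx i 0).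
by rewrite /mxform trmx_delta -mulmxA -rowE mxE.
Qed.

Lemma mx_expS X i : X ^+ i.+1 = X *m X ^+ i.
Proof. exact: exprS. Qed.

Lemma mx_expSr X i : X ^+ i.+1 = X ^+ i *m X.
Proof. exact: exprSr. Qed.

Definition skew_for G X : Prop := X^T *m G = - (G *m X).

Lemma skew_formE G X u v : skew_for G X ->
  mxform G (X *m u) v = - mxform G u (X *m v).
Proof. by move=> sX; rewrite mxform_mull sX mxformN mxform_mulr. Qed.

Lemma skew_for_tr G X : skew_for G X -> skew_for G^T X.
Proof.
move=> sX; rewrite /skew_for -trmx_mul -[X in _ = - (_ *m X)]trmxK -trmx_mul sX.
by rewrite linearN opprK.
Qed.

(** Skewness for G is skewness for G - G^T and for G + G^T, the second of
    which is the first composed with t: given the first, the second says that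
    X commutes with t. *)
Lemma skew_for_centraliser G t X : (2 : F) != 0 ->
  G - G^T \in unitmx -> (G - G^T) *m t = G + G^T ->
  skew_for G X <-> skew_for (G - G^T) X /\ t *m X = X *m t.
Proof.
set Om := G - G^T => two_neq0 Omunit Omt.
have OmSym : Om + (G + G^T) = G + G by rewrite addrACA addNr addr0.
split=> [sX|[sX tX]].
  have sX' := skew_for_tr sX.
  have sOm : skew_for Om X.
    by rewrite /skew_for mulmxBr mulmxBl sX sX' !opprB opprK addrC.
  split=> //; apply: (can_inj (mulKmx Omunit)).
  rewrite !mulmxA Omt -[Om *m X]opprK -sOm mulNmx -mulmxA Omt.
  by rewrite mulmxDr mulmxDl sX sX' -opprD opprK.
have sSym : X^T *m (G + G^T) = - ((G + G^T) *m X).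
  by rewrite -Omt mulmxA sX mulNmx -!mulmxA tX.
have : X^T *m (G + G) = - ((G + G) *m X).
  by rewrite -OmSym mulmxDr mulmxDl sX sSym opprD.
rewrite mulmxDr mulmxDl opprD => /eqP; rewrite -subr_eq0 opprD !opprK addrACA.
rewrite addr_eq0 => /eqP/(mx_double_eq0 two_neq0)/eqP.
by rewrite addr_eq0 => /eqP.
Qed.

(** * The symplectic Lie algebra is reductive *)

Section Symplectic.
Variables (T : vectType F) (br : T -> T -> T) (L : {vspace T}).
Variables (Phi : {linear T -> 'M[F]_n}) (G : 'M[F]_n).
Hypotheses (two_neq0 : (2 : F) != 0) (repL : faithful_rep br L Phi).
Hypotheses (Gskew : G^T = - G) (Gunit : G \in unitmx).

(** An abelian ideal I vanishes. Let X represent an element of I and let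
    Y = u *m u^T *m G. Since [Y, X] also comes from I, it commutes with X, that
    is 2 X Y X = X^2 Y + Y X^2. Evaluating G(u, _ u) gives 2 G(u, X u)^2 = 0, as
    G(u, u) = 0. So the symmetric matrix G *m X is alternating, hence zero. *)
Lemma symplectic_reductive :
  (forall x, x \in L -> skew_for G (Phi x)) ->
  (forall u, exists2 x, x \in L & Phi x = u *m u^T *m G) ->
  lie_reductive br L.
Proof.
move=> Lskew Louter; apply: (lie_reductive_no_abelian_ideal repL) => I.
have [brL Phibr Phi0] := repL.
move=> [/subvP IL Iid] Iab; apply/eqP; rewrite -subv0; apply/subvP => x xI.
have xL := IL _ xI; rewrite memv0; apply/eqP/Phi0 => //.
set X := Phi x; have sX : skew_for G X by exact: Lskew.
have GX0 u : mxform (G *m X) u u = 0.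
  have [y yL Ey] := Louter u.
  have Y_mul v : Phi y *m v = mxform G u v *: u by rewrite Ey outerE.
  have /(congr1 Phi) := Iab x (br y x) xI (Iid _ _ yL xI).
  rewrite linear0 !Phibr ?brL // -/X => /(congr1 (mulmx^~ u)).
  rewrite mul0mx !mulmxBl !mulmxBr !mulmxBl -!mulmxA !Y_mul.
  rewrite (mxform_skew_alt u two_neq0 Gskew) scale0r !mulmx0 subr0.
  move/(congr1 (mxform G u)).
  rewrite -!scaleN1r -!scalemxAr !(mxformDr, mxformZr).
  rewrite (mxform_skew_alt u two_neq0 Gskew) mxform0r -mxform_mulr.
  set c := mxform G u _ => c2; apply/eqP; rewrite -sqrf_eq0.
  by apply/eqP/(mulfI two_neq0); rewrite mulr0 -[RHS]c2; ring.
have GXN : G *m X = - (G *m X).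
  by rewrite -(mxform_alt_skew GX0) trmx_mul Gskew mulmxN sX opprK.
by rewrite -(mulKmx Gunit X) (mx_double_eq0 two_neq0 GXN) mulmx0.
Qed.
End Symplectic.
End BilinearForms.

(** * The centraliser of a non-regular nilpotent element *)

Lemma sum_shift (V : zmodType) (g : nat -> V) m : g 0%N = 0 -> g m = 0 ->
  \sum_(i < m) g i.+1 = \sum_(i < m) g i.
Proof.
move=> g0 gm; transitivity (\sum_(i < m.+1) g i).
  by rewrite big_ord_recl /= g0 add0r; apply: eq_bigr.
by rewrite big_ord_recr /= gm addr0.
Qed.

Section NilpotentCentraliser.
Variables (F : fieldType) (n : nat) (G t : 'M[F]_n) (j : nat).
Variables (T : vectType F) (br : T -> T -> T) (L : {vspace T}).
Variable Phi : {linear T -> 'M[F]_n}.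
Hypotheses (two_neq0 : (2 : F) != 0) (Gskew : G^T = - G) (Gunit : G \in unitmx).
Hypotheses (tskew : skew_for G t) (repL : faithful_rep br L Phi).
(* The nilpotency index of t is j.+2, so that t is not zero, and it is less than
   n, so that t has several Jordan blocks. *)
Hypotheses (tnil : t ^+ j.+2 = 0) (tj_neq0 : t ^+ j.+1 != 0).
Hypothesis ltjn : (j.+2 < n)%N.
Hypothesis L_skew : forall x, x \in L -> skew_for G (Phi x).
Hypothesis L_comm : forall x, x \in L -> t *m Phi x = Phi x *m t.
Hypothesis L_surj : forall X, skew_for G X -> t *m X = X *m t ->
  exists2 x, x \in L & Phi x = X.

Let q : 'M[F]_n := t ^+ j.+1.

(** The columns of this matrix span the kernel of t; as t is skew, its image is
    the orthogonal of these columns. *)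
Definition ker_gen : 'M[F]_n := (kermx t^T)^T.
Local Notation kap := ker_gen.

Lemma mul_ker_gen : t *m kap = 0.
Proof. by apply: trmx_inj; rewrite trmx_mul trmxK mulmx_ker trmx0. Qed.

Lemma ker_genP p (Z : 'M[F]_(n, p)) : t *m Z = 0 -> exists D, Z = kap *m D.
Proof.
move=> tZ; have /submxP[D DE] : (Z^T <= kermx t^T)%MS.
  by apply/sub_kermxP; rewrite -trmx_mul tZ trmx0.
by exists D^T; apply: trmx_inj; rewrite trmx_mul !trmxK.
Qed.

(** An ideal of elements with image in ker t that is meant to be solvable: they
    also send ker t into im t, a condition stated as orthogonality to ker t. *)
Definition nil_ideal : {vspace T} :=
  (L :&: lker (linfun (mulmx t \o Phi))
     :&: lker (linfun (mulmxr kap \o (mulmx (kap^T *m G) \o Phi))))%VS.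

Lemma nil_idealP x : reflect
  [/\ x \in L, t *m Phi x = 0 & kap^T *m G *m Phi x *m kap = 0]
  (x \in nil_ideal).
Proof.
rewrite !memv_cap !memv_ker !lfunE /=.
by apply: (iffP andP) => [[/andP[-> /eqP->] /eqP->] | [-> -> ->]]; rewrite ?eqxx.
Qed.

(** G (Phi x) (Phi y) z is a matrix of values of y on ker t paired with ker t:
    skewness moves x to the left of G, where its image lies in ker t, and z
    takes its values in ker t. *)
Lemma nil_ideal_sandwich x y z :
  x \in nil_ideal -> y \in nil_ideal -> t *m z = 0 ->
  Phi x *m Phi y *m (z : 'M_n) = 0.
Proof.
move=> /nil_idealP[xL tx _] /nil_idealP[_ _ ky] /ker_genP[D ->].
have [C Ex] := ker_genP tx.
apply: (can_inj (mulKmx Gunit)); rewrite mulmx0 !mulmxA.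
have -> : G *m Phi x = - ((Phi x)^T *m G) by rewrite L_skew // opprK.
have kyD : kap^T *m (G *m (Phi y *m (kap *m D))) = 0.
  by rewrite !mulmxA ky mul0mx.
by rewrite Ex trmx_mul !mulNmx -!mulmxA kyD mulmx0 oppr0.
Qed.

Lemma nil_ideal_ideal : lie_ideal br L nil_ideal.
Proof.
have [brL Phibr _] := repL.
split=> [|y x yL]; first by apply/subvP => x /nil_idealP[].
case/nil_idealP => xL tx kx; apply/nil_idealP; rewrite brL // Phibr //.
have [D yD] : exists D, Phi y *m kap = kap *m D.
  by apply: ker_genP; rewrite mulmxA L_comm // -mulmxA mul_ker_gen mulmx0.
have kD : kap^T *m G *m Phi y = - (D^T *m kap^T *m G).
  have -> : kap^T *m G *m Phi y = - (kap^T *m (Phi y)^T *m G).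
    by rewrite -!mulmxA L_skew // mulmxN opprK.
  by rewrite -!trmx_mul yD.
split=> //.
  by rewrite mulmxBr !mulmxA tx L_comm // -mulmxA tx mulmx0 mul0mx subrr.
have -> : kap^T *m G *m (Phi y *m Phi x - Phi x *m Phi y) *m kap =
    kap^T *m G *m Phi y *m Phi x *m kap - kap^T *m G *m Phi x *m (Phi y *m kap).
  by rewrite mulmxBr mulmxBl !mulmxA.
have kx' : kap^T *m (G *m (Phi x *m kap)) = 0 by rewrite !mulmxA.
rewrite kD yD [_ *m (kap *m D)]mulmxA kx mul0mx subr0 !mulNmx -!mulmxA kx'.
by rewrite mulmx0 oppr0.
Qed.

(** A product of two elements of the ideal kills ker t, so the derived ideal
    kills ker t, and its elements have image in ker t: they multiply to zero. *)
Lemma nil_ideal_solvable : lie_solvable br nil_ideal.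
Proof.
have [brL Phibr Phi0] := repL.
pose D := (nil_ideal :&: lker (linfun (mulmxr kap \o Phi)))%VS.
have DP x : reflect (x \in nil_ideal /\ Phi x *m kap = 0) (x \in D).
  rewrite /D; apply: (iffP memv_capP); rewrite [x \in lker _]memv_ker lfunE /=.
    by case=> xJ /eqP.
  by case=> xJ ->.
have [/subvP JL Jid] := nil_ideal_ideal.
have prodD : (lie_prod br nil_ideal nil_ideal <= D)%VS.
  apply: lie_prod_sub => x y xJ yJ; apply/DP; split; first by rewrite Jid ?JL.
  rewrite Phibr ?JL // mulmxBl !nil_ideal_sandwich ?subrr //; exact: mul_ker_gen.
exists 2; apply/eqP; rewrite -subv0; apply: lie_prod_sub => x y.
move=> /(subvP prodD)/DP[xJ xk] /(subvP prodD)/DP[yJ yk].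
rewrite memv0; apply/eqP/Phi0; rewrite ?brL ?JL // Phibr ?JL //.
have /nil_idealP[_ /ker_genP[Cx Ex] _] := xJ.
have /nil_idealP[_ /ker_genP[Cy Ey] _] := yJ.
by rewrite {1}Ey {2}Ex !mulmxA xk yk !mul0mx subrr.
Qed.

Lemma skew_exp i : (t ^+ i)^T *m G = (-1) ^+ i *: (G *m t ^+ i).
Proof.
elim: i => [|i IHi]; first by rewrite !expr0 scale1r trmx1 mulmx1 mul1mx.
rewrite mx_expSr trmx_mul -mulmxA IHi -scalemxAr.
rewrite (mulmxA t^T) tskew mulNmx -mulmxA -mx_expS -mx_expSr.
by rewrite [(-1) ^+ i.+1]exprS mulN1r scaleNr scalerN.
Qed.

(** This is the map v |-> (p, v) w + (w, v) p with p = q e. It belongs to the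
    ideal because p and w are in ker t and p, being in im t, is orthogonal to
    ker t. *)
Lemma nil_ideal_elt (e w : 'cV[F]_n) : t *m w = 0 -> exists2 x,
  x \in nil_ideal & Phi x = (w *m (q *m e)^T + q *m e *m w^T) *m G.
Proof.
move=> tw.
have tG : G *m t = - (t^T *m G) by rewrite tskew opprK.
have tp : t *m (q *m e) = 0 by rewrite mulmxA -mx_expS tnil mul0mx.
have kp : kap^T *m G *m (q *m e) = 0.
  rewrite /q mx_expS !mulmxA -(mulmxA _ G) tG mulmxN mulmxA -trmx_mul.
  by rewrite mul_ker_gen trmx0 mul0mx oppr0 !mul0mx.
move: (q *m e) tp kp => p tp kp.
have sX : skew_for G ((w *m p^T + p *m w^T) *m G).
  have ST : (w *m p^T + p *m w^T)^T = w *m p^T + p *m w^T.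
    by rewrite linearD /= !trmx_mul !trmxK addrC.
  by rewrite /skew_for trmx_mul Gskew ST !mulNmx mulmxA.
have tX : t *m ((w *m p^T + p *m w^T) *m G) = 0.
  by rewrite mulmxA mulmxDr !mulmxA tw tp !mul0mx addr0 mul0mx.
have Xt : (w *m p^T + p *m w^T) *m G *m t = 0.
  rewrite -mulmxA tG mulmxN mulmxA mulmxDl -(mulmxA w) -(mulmxA p) -!trmx_mul.
  by rewrite tw tp trmx0 !mulmx0 addr0 mul0mx oppr0.
have [|x xL Ex] := L_surj sX; first by rewrite tX Xt.
exists x => //; apply/nil_idealP; rewrite Ex; split=> //.
have pk : p^T *m G *m kap = 0.
  apply: trmx_inj; rewrite !trmx_mul (trmxK p) Gskew mulNmx mulmxN mulmxA kp.
  by rewrite trmx0 oppr0.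
have -> : kap^T *m G *m ((w *m p^T + p *m w^T) *m G) *m kap =
    kap^T *m G *m w *m (p^T *m G *m kap) + kap^T *m G *m p *m (w^T *m G *m kap).
  by rewrite mulmxDl mulmxDr mulmxDl !mulmxA.
by rewrite pk kp mulmx0 mul0mx addr0.
Qed.

(** Averaging Z *m G over the powers of t, as in the sum of the
    t^i (Z *m G) t^(j + 1 - i), gives an operator that commutes with t because
    t^(j + 2) = 0. Taking adjoints reverses the sum and multiplies it by a sign,
    which the symmetry required of Z compensates. On ker t only the term with
    i = j + 1 survives. *)
Lemma centraliser_elt Z : Z^T = (-1) ^+ j.+1 *: Z ->
  exists2 y, y \in L & forall w : 'cV_n, t *m w = 0 ->
    Phi y *m w = q *m Z *m G *m w.
Proof.
move=> ZT; pose A := Z *m G.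
pose Y : 'M[F]_n := \sum_(i < j.+2) t ^+ i *m A *m t ^+ (j.+1 - i).
have sY : skew_for G Y.
  rewrite /skew_for linear_sum /= mulmx_suml mulmx_sumr -sumrN.
  rewrite (reindex_inj rev_ord_inj) /=; apply: eq_bigr => i _.
  have lei : (i <= j.+1)%N by rewrite -ltnS.
  rewrite subSS subKn //; set m := (j.+1 - i)%N.
  have sgn : (-1) ^+ m * (-1) ^+ j.+1 * (-1) ^+ i = 1 :> F.
    by rewrite mulrAC -exprD subnK // -expr2 sqrr_sign.
  rewrite !trmx_mul -!mulmxA skew_exp Gskew ZT -!scalemxAr -scalemxAl.
  rewrite !mulNmx mulmxN -!scalemxAr (mulmxA (t ^+ i)^T) skew_exp -!scalemxAl.
  by rewrite !scalerN !scalerA sgn scale1r -!mulmxA.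
have tY : t *m Y = Y *m t.
  pose g i : 'M[F]_n := t ^+ i *m A *m t ^+ (j.+2 - i).
  have -> : t *m Y = \sum_(i < j.+2) g i.+1.
    rewrite mulmx_sumr; apply: eq_bigr => i _.
    by rewrite /g !mulmxA -mx_expS subSS.
  have -> : Y *m t = \sum_(i < j.+2) g i.
    rewrite mulmx_suml; apply: eq_bigr => i _; rewrite /g -mulmxA -mx_expSr.
    by rewrite [(j.+2 - i)%N]subSn // -ltnS.
  by apply: sum_shift; rewrite /g ?subn0 tnil ?mulmx0 ?mul0mx.
have [y yL Ey] := L_surj sY tY; exists y => // w tw; rewrite Ey.
rewrite mulmx_suml big_ord_recr /= subnn expr0 mulmx1 /A !mulmxA.
rewrite [X in X + _]big1 => [|i _]; first by rewrite add0r.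
rewrite (@subSn i j).
  rewrite mx_expSr.
  by rewrite -!mulmxA tw !mulmx0.
by rewrite -ltnS.
Qed.

(** By skewness, (X v, Y v) = - (v, X Y v) and (Y v, X v) = - (v, Y X v): these
    agree, but they are also opposite. This turns non-centrality into the search
    for one vector v. *)
Lemma skew_commuting_form X Y (v : 'cV_n) :
  skew_for G X -> skew_for G Y -> X *m Y = Y *m X ->
  mxform G (X *m v) (Y *m v) = 0.
Proof.
move=> sX sY XY; apply: (mulfI two_neq0); rewrite mulr0 mulr_natl mulr2n.
rewrite {1}mxform_tr Gskew mxformN !skew_formE // !mulmxA XY.
by rewrite opprK subrr.
Qed.

Lemma reductive_nil_ideal_comm x y : lie_reductive br L ->
  x \in nil_ideal -> y \in L -> Phi x *m Phi y = Phi y *m Phi x.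
Proof.
move=> redL xJ yL; have [_ Phibr _] := repL; have [xL _ _] := nil_idealP _ xJ.
have /(congr1 Phi) := redL _ nil_ideal_ideal nil_ideal_solvable y x yL xJ.
by rewrite Phibr // linear0 => /subr0_eq.
Qed.

(** As j + 2 < n, some non-zero v is orthogonal to e, t e, ..., t^(j + 1) e; the
    last non-zero t^i v is then in ker t and orthogonal to e. *)
Lemma ker_orth_vector (e : 'cV[F]_n) :
  exists w : 'cV[F]_n, [/\ w != 0, t *m w = 0 & mxform G w e = 0].
Proof.
pose C : 'M[F]_(n, j.+2) := \matrix_(r, i) (t ^+ i *m e) r 0.
have : kermx (G *m C) != 0.
  rewrite kermx_eq0 /row_free neq_ltn; apply/orP; left.
  exact: leq_ltn_trans (rank_leq_col _) ltjn.
case/rowV0Pn => u /sub_kermxP uGC u0; pose v := u^T.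
have v0 : v != 0 by rewrite -trmx0 (inj_eq trmx_inj).
have v_orth i : (i < j.+2)%N -> mxform G v (t ^+ i *m e) = 0.
  move=> ltij; have /matrixP/(_ 0 (Ordinal ltij)) := uGC; rewrite mulmxA !mxE => <-.
  by rewrite /mxform /v trmxK !mxE; apply: eq_bigr => r _; rewrite !mxE.
have ex_i : exists i, t ^+ i *m v == 0 by exists j.+2; rewrite tnil mul0mx.
case: (ex_minnP ex_i) => -[|i]; first by rewrite expr0 mul1mx (negPf v0).
rewrite mx_expS -mulmxA => /eqP tw minw; exists (t ^+ i *m v); split=> //.
  by apply/negP => /minw; rewrite ltnn.
have ltij : (i < j.+2)%N by apply: minw; rewrite tnil mul0mx.
by rewrite mxform_mull skew_exp /mxform -scalemxAr -scalemxAl mxE -/(mxform _ _ _)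
  -mxform_mulr v_orth // mulr0.
Qed.

(** If (e, q e) were not zero, the span of e, t e, ..., q e would be a
    nondegenerate Jordan block. With w in ker t orthogonal to e, the element
    x : v |-> (q e, v) w + (w, v) q e of the ideal, which joins this block to
    its orthogonal complement, fails to commute with the average y of w' e^T - e w'^T, for w'
    not orthogonal to w: in fact (x e, y e) = (q e, e)^2 (w', w). *)
Lemma reductive_exp_alt_even (e : 'cV[F]_n) : lie_reductive br L -> ~~ odd j ->
  mxform G e (q *m e) = 0.
Proof.
move=> redL j_even; apply/eqP/negPn/negP; rewrite mxform_swap // oppr_eq0 => pe.
have [w [w0 tw we]] := ker_orth_vector e.
have [w' w'w] := mxform_nondegenerate Gunit w0.
have [x xJ Ex] := nil_ideal_elt e tw.
have ew : mxform G e w = 0 by rewrite mxform_swap // we oppr0.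
have [|y yL Ey] := @centraliser_elt (w' *m e^T - e *m w'^T).
  rewrite -signr_odd /= j_even expr1 scaleN1r linearB /= !trmx_mul !trmxK.
  by rewrite opprB.
have Eyw : Phi y *m w = - mxform G w' w *: (q *m e).
  rewrite Ey // -2!(mulmxA q) !mulmxBl !outerE ew scale0r sub0r.
  by rewrite mulmxN -scalemxAr scaleNr.
have Exe : Phi x *m e = mxform G (q *m e) e *: w.
  by rewrite Ex !mulmxDl !outerE we scale0r addr0.
have [xL _ _] := nil_idealP _ xJ.
have := skew_commuting_form e (L_skew xL) (L_skew yL)
  (reductive_nil_ideal_comm redL xJ yL).
rewrite Exe mxformZl -[mxform G w _]opprK -skew_formE ?Eyw; last exact: L_skew.
rewrite mxformZl mulNr opprK; apply/eqP; rewrite !mulf_neq0 //.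
Qed.

Lemma reductive_exp_alt (e : 'cV[F]_n) : lie_reductive br L ->
  mxform G e (q *m e) = 0.
Proof.
move=> redL; case: (boolP (odd j)) => [j_odd|]; last exact: reductive_exp_alt_even.
(* For odd j, the matrix G *m q is skew. *)
rewrite mxform_mulr mxform_skew_alt // trmx_mul Gskew mulmxN skew_exp.
by rewrite -signr_odd /= j_odd scale1r.
Qed.

(** Since G *m q is alternating but not zero, it is skew and j is odd. Take b
    and e with (b, q e) non-zero. The element of the ideal sending v to
    2 (q e, v) q e does not commute with the average of b b^T, as the vector
    e + b shows. *)
Lemma nilpotent_centraliser_not_reductive : ~ lie_reductive br L.
Proof.
move=> redL.
have q_alt e := reductive_exp_alt e redL.
have Gq_skew : (G *m q)^T = - (G *m q).
  by apply: mxform_alt_skew => u; rewrite -mxform_mulr.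
have Gq0 : G *m q != 0.
  by apply: contraNneq tj_neq0 => Gq; rewrite -(mulKmx Gunit (t ^+ j.+1)) Gq mulmx0.
have j_odd : odd j.
  apply/negPn/negP => j_even; case/eqP: Gq0; apply: mx_double_eq0 => //.
  rewrite -{1}Gq_skew trmx_mul Gskew mulmxN skew_exp -signr_odd /= j_even.
  by rewrite expr1 scaleN1r opprK.
have [b [e be]] : exists b e, mxform G b (q *m e) != 0.
  case/matrix0Pn: Gq0 => r [s Grs]; exists (delta_mx r 0), (delta_mx s 0).
  by rewrite mxform_mulr mxform_delta.
have tp : t *m (q *m e) = 0 by rewrite mulmxA -mx_expS tnil mul0mx.
have [x xJ Ex] := nil_ideal_elt e tp.
have [|y yL Ey] := @centraliser_elt (b *m b^T).
  by rewrite -signr_odd /= j_odd scale1r trmx_mul trmxK.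
have [xL _ _] := nil_idealP _ xJ.
have := skew_commuting_form (e + b) (L_skew xL) (L_skew yL)
  (reductive_nil_ideal_comm redL xJ yL).
have -> : Phi x *m (e + b) = - (mxform G b (q *m e) *+ 2) *: (q *m e).
  rewrite Ex mulmxDl !mulmxDl !outerE -scalerDl -mulr2n mxformDr.
  by rewrite ![mxform G (q *m e) _]mxform_swap // q_alt oppr0 add0r mulNrn.
have Eyp : Phi y *m (q *m e) = mxform G b (q *m e) *: (q *m b).
  by rewrite Ey // -2!(mulmxA q) outerE -scalemxAr.
rewrite mxformZl -[mxform G (q *m e) _]opprK -skew_formE ?Eyp; last exact: L_skew.
rewrite mxformZl mxformDr ![mxform G (q *m b) _]mxform_swap // q_alt subr0.
rewrite [mxform G e _]mxform_mulr [mxform _ e b]mxform_tr Gq_skew mxformN.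
rewrite -mxform_mulr.
by apply/eqP; rewrite -mulr_natl !(mulf_eq0, oppr_eq0) !negb_or two_neq0 be.
Qed.

End NilpotentCentraliser.

(** * Cyclic matrices with the single eigenvalue -1 *)

Section CyclicNilpotent.
Variable F : fieldType.

Lemma mxminpoly_quasi_unipotent m (A : 'M[F]_m.+1) k : (A + 1) ^+ k = 0 ->
  exists2 d, (d <= m.+1)%N & mxminpoly A = ('X - (-1)%:P) ^+ d.
Proof.
move=> Ak.
have : mxminpoly A %| ('X - (-1)%:P) ^+ k.
  apply: mxminpoly_min; rewrite rmorphXn rmorphB /= horner_mx_X horner_mx_C.
  by rewrite -[RHS]Ak rmorphN1 opprK.
case/dvdp_exp_XsubCP => d _ eqd; have Ad : mxminpoly A = ('X - (-1)%:P) ^+ d.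
  apply/eqP; rewrite -eqp_monic ?mxminpoly_monic //.
  by rewrite monic_exp // monicXsubC.
exists d => //.
rewrite -ltnS -[d.+1](size_exp_XsubC d (-1 : F)) -(size_char_poly A) -Ad.
apply: dvdp_leq (mxminpoly_dvd_char A).
by rewrite monic_neq0 ?char_poly_monic.
Qed.

Lemma quasi_unipotent_exp n (A : 'M[F]_n) k : (A + 1%:M) ^+ k = 0 ->
  (A + 1%:M) ^+ n = 0.
Proof.
case: n A => [|m] A Ak; first by apply/matrixP; case.
have [d ltd Ad] := mxminpoly_quasi_unipotent Ak.
have : horner_mx A (('X - (-1)%:P) ^+ d) = 0 by rewrite -Ad mx_root_minpoly.
rewrite rmorphXn rmorphB /= horner_mx_X horner_mx_C rmorphN1 opprK => Nd.
have : (A + 1%:M) ^+ (m.+1 - d + d) = 0 by rewrite exprD [_ ^+ d]Nd mulr0.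
by rewrite subnK.
Qed.

(** The minimal polynomial is a power of 'X + 1 that divides the characteristic
    polynomial, of degree n; they are equal when its exponent exceeds n - 1. The
    cast by conform_mx is the identity up to the equality n = n.-1.+1. *)
Lemma cyclic_mxE n (A : 'M[F]_n) k : (0 < n)%N -> (A + 1%:M) ^+ k = 0 ->
  let C := conform_mx 0 A : 'M[F]_n.-1.+1 in
  mxminpoly C = char_poly C <-> (A + 1%:M) ^+ n.-1 != 0.
Proof.
case: n A => // m A _ Ak; rewrite /= conform_mx_id.
have hornerE j : horner_mx A (('X - (-1)%:P) ^+ j) = (A + 1%:M) ^+ j.
  by rewrite rmorphXn rmorphB /= horner_mx_X horner_mx_C rmorphN1 opprK.
have [d ltd Ad] := mxminpoly_quasi_unipotent Ak; split=> [cycA|].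
  apply/negP; rewrite -hornerE -dvd_mxminpoly cycA.
  have nz : ('X - (-1)%:P) ^+ m != 0 :> {poly F}.
    by rewrite expf_neq0 // polyXsubC_eq0.
  by move/(dvdp_leq nz); rewrite size_char_poly size_exp_XsubC ltnn.
move=> Am; apply/eqP; rewrite -eqp_monic ?mxminpoly_monic ?char_poly_monic //.
rewrite -dvdp_size_eqp ?mxminpoly_dvd_char // size_char_poly Ad size_exp_XsubC.
rewrite eqSS eqn_leq ltd ltnNge; apply: contra Am => ledm.
by rewrite -hornerE -dvd_mxminpoly Ad dvdp_exp2l.
Qed.

(** Independence of the v N^i is read off by multiplying a relation by
    N^(n - 1 - i), where i is the least index with a non-zero coefficient. *)
Lemma cyclic_nilpotent_basis n (N : 'M[F]_n) (v : 'rV[F]_n) :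
  N ^+ n = 0 -> v *m N ^+ n.-1 != 0 ->
  forall u : 'rV[F]_n, exists c : 'rV[F]_n, u = \sum_i c 0 i *: (v *m N ^+ i).
Proof.
case: n N v => [|m] N v /= Nn vN u.
  by exists 0; apply/rowP; case.
pose B : 'M[F]_m.+1 := \matrix_i (v *m N ^+ i).
have mulB c : c *m B = \sum_i c 0 i *: (v *m N ^+ i).
  by rewrite mulmx_sum_row; apply: eq_bigr => i _; rewrite rowK.
have Bfree : row_free B.
  apply/inj_row_free => c cB; apply/rowP => i; rewrite mxE.
  case: i; elim/ltn_ind => i IHi lti.
  move/(congr1 (mulmx^~ (N ^+ (m - i)))): cB.
  rewrite mulB mul0mx mulmx_suml (bigD1 (Ordinal lti)) //=.
  rewrite big1 ?addr0 => [|[l ltl] neq].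
    rewrite -scalemxAl -mulmxA -[N ^+ i *m _]exprD subnKC // => /eqP.
    by rewrite scalemx_eq0 (negPf vN) orbF => /eqP.
  rewrite -scalemxAl; case: (ltngtP l i) => [lti'|gti|eqi].
  - by rewrite IHi // scale0r.
  - rewrite -mulmxA -[N ^+ l *m _]exprD.
    have -> : (l + (m - i) = m.+1 + (l - i.+1))%N by lia.
    by rewrite exprD Nn mul0r mulmx0 scaler0.
  - by case/eqP: neq; apply: val_inj.
by exists (u *m invmx B); rewrite -mulB mulmxKV // -row_free_unit.
Qed.

(** A matrix X commuting with N is determined by the image of a cyclic vector v;
    if v X = v P with P a polynomial in N, then X = P. *)
Lemma cyclic_nilpotent_comm n (N X Y : 'M[F]_n) :
  N ^+ n = 0 -> N ^+ n.-1 != 0 -> X *m N = N *m X -> Y *m N = N *m Y ->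
  X *m Y = Y *m X.
Proof.
move=> Nn Nn1 XN YN.
have [i vN] : exists i, row i 1%:M *m N ^+ n.-1 != 0.
  apply/existsP; apply: contraNT Nn1; rewrite negb_exists => /forallP N0.
  apply/eqP/row_matrixP => i; rewrite row0 -[N ^+ n.-1]mul1mx row_mul.
  by apply/eqP/negPn.
have basis := cyclic_nilpotent_basis Nn vN; set v := row i _ in basis.
have pow_comm Z k : Z *m N = N *m Z -> Z *m N ^+ k = N ^+ k *m Z.
  exact: commrX.
have [c Xv] := basis (v *m X); pose P := \sum_i c 0 i *: N ^+ i.
have vX : v *m X = v *m P.
  by rewrite Xv mulmx_sumr; apply: eq_bigr => k _; rewrite scalemxAr.
have comP Z : Z *m N = N *m Z -> Z *m P = P *m Z.
  move=> ZN; rewrite mulmx_sumr mulmx_suml; apply: eq_bigr => k _.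
  by rewrite -scalemxAr pow_comm // scalemxAl.
have -> : X = P.
  apply/row_matrixP => k; rewrite [X]lock [P]lock !rowE -!lock.
  have [d ->] := basis (delta_mx 0 k).
  rewrite !mulmx_suml; apply: eq_bigr => l _; rewrite -!scalemxAl; congr (_ *: _).
  by rewrite -!mulmxA -!pow_comm // ?comP // !mulmxA vX.
by rewrite comP.
Qed.
End CyclicNilpotent.

(** * Reduction to the centraliser of a nilpotent element *)

Section QuasiUnipotentAsymmetry.
Variables (F : fieldType) (n : nat) (G S : 'M[F]_n).
Variables (T : vectType F) (br : T -> T -> T) (L : {vspace T}).
Variable Phi : {linear T -> 'M[F]_n}.
Hypotheses (two_neq0 : (2 : F) != 0) (Gunit : G \in unitmx) (GS : G^T = G *m S).
Hypothesis repL : faithful_rep br L Phi.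
Hypothesis L_skew : forall x, x \in L -> skew_for G (Phi x).
Hypothesis L_surj : forall X, skew_for G X -> exists2 x, x \in L & Phi x = X.

Let N : 'M[F]_n := S + 1%:M.
Let M : 'M[F]_n := 2%:M - N.
Let Om : 'M[F]_n := G - G^T.

(** The asymmetry gives Om = G (2 - N) and G + G^T = G N, so t is N times the
    inverse of 2 - N: it commutes with N, and N^k = (2 - N)^k t^k vanishes
    exactly when t^k does. *)
Lemma noncyclic_not_reductive :
  N ^+ n.-1 = 0 -> N != 0 -> ~ lie_reductive br L.
Proof.
move=> Nn N0.
(* Otherwise 2 would be an eigenvalue of N, and its powers, which are non-zero,
   eigenvalues of the powers of N. *)
have Munit : M \in unitmx.
  rewrite -row_free_unit; apply/inj_row_free => u /eqP.
  rewrite mulmxBr mul_mx_scalar subr_eq0 eq_sym => /eqP uN.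
  have uNk k : u *m N ^+ k = 2 ^+ k *: u.
    elim: k => [|k IHk]; first by rewrite !expr0 mulmx1 scale1r.
    by rewrite mx_expSr mulmxA IHk -scalemxAl uN scalerA -exprSr.
  have /eqP := uNk n.-1; rewrite Nn mulmx0 eq_sym scalemx_eq0 expf_eq0.
  by rewrite (negPf two_neq0) andbF => /eqP.
have GM : Om = G *m M.
  rewrite /Om GS /M /N (_ : 2%:M = 1%:M + 1%:M); last by rewrite -raddfD.
  by rewrite opprD addrA addrAC addrK mulmxBr mulmx1.
have GN : G + G^T = G *m N by rewrite GS mulmxDr mulmx1 addrC.
have Omunit : Om \in unitmx by rewrite GM unitmx_mul Gunit.
have [t Omt] : exists t, Om *m t = G + G^T.
  by exists (invmx Om *m (G + G^T)); rewrite mulKVmx.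
have Omskew : Om^T = - Om by rewrite linearB /= trmxK opprB.
have Symtr : (G + G^T)^T = G + G^T by rewrite linearD /= trmxK addrC.
have tskew : skew_for Om t.
  have : (Om *m t)^T = Om *m t by rewrite Omt Symtr.
  by rewrite trmx_mul Omskew mulmxN /skew_for => <-; rewrite opprK.
have Mt : M *m t = N.
  by apply: (can_inj (mulKmx Gunit)); rewrite mulmxA -GM Omt GN.
have MN : M *m N = N *m M by rewrite mulmxBl mulmxBr scalar_mxC.
have tM : t *m M = N.
  by apply: (can_inj (mulKmx Munit)); rewrite mulmxA Mt MN.
have expMt k : N ^+ k = M ^+ k *m t ^+ k.
  rewrite -[in LHS]Mt; apply: exprMn_comm.
  by rewrite /GRing.comm [M * t]Mt [t * M]tM.
have texp0 k : N ^+ k = 0 -> t ^+ k = 0.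
  rewrite expMt => Mtk; apply: (can_inj (mulKmx (_ : M ^+ k \in unitmx))).
    by elim: k {Mtk} => [|k IHk]; rewrite ?unitmx1 // mx_expS unitmx_mul Munit.
  by rewrite Mtk mulmx0.
have t0 : t != 0 by apply: contraNneq N0 => tz; rewrite -Mt tz mulmx0.
have ex_k : exists k, t ^+ k == 0 by exists n.-1; rewrite texp0.
case: (ex_minnP ex_k) => -[|[|j]] /eqP tk kmin.
- by rewrite -[t]mul1mx [1%:M]tk mul0mx eqxx in t0.
- by rewrite -[t]expr1 tk eqxx in t0.
have ltjn : (j.+2 < n)%N.
  by have := kmin n.-1; rewrite texp0 // => /(_ (eqxx _)); case: (n).
have tj0 : t ^+ j.+1 != 0 by apply/negP => /kmin; rewrite ltnn.
have skewE X := skew_for_centraliser X two_neq0 Omunit Omt.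
apply: (nilpotent_centraliser_not_reductive two_neq0 Omskew Omunit tskew repL
  tk tj0 ltjn).
- by move=> x /L_skew/skewE[].
- by move=> x /L_skew/skewE[].
- by move=> X sX tX; apply: L_surj; apply/skewE.
Qed.
End QuasiUnipotentAsymmetry.

(** * Extension of scalars *)

Section ScalarExtension.
Variables (F : fieldType) (T : vectType F) (br : T -> T -> T) (L : {vspace T}).
Variables (n : nat) (Phi : {linear T -> 'M[F]_n}).
Hypothesis repL : faithful_rep br L Phi.
Variables (K : fieldType) (iota : {rmorphism F -> K}).
Local Notation d := (\dim L).
Local Notation b := (vbasis L).
Local Notation "A ^iota" := (map_mx iota A) (at level 2, format "A ^iota").

Definition ext_rep (u : 'rV[K]_d) : 'M[K]_n := \sum_i u 0 i *: (Phi b`_i)^iota.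

Fact ext_rep_linear : linear ext_rep.
Proof.
move=> a u v; rewrite /ext_rep scaler_sumr -big_split; apply: eq_bigr => i _.
by rewrite !mxE scalerDl scalerA.
Qed.
HB.instance Definition _ := GRing.isSemilinear.Build K _ _ _ ext_rep
  (GRing.semilinear_linear ext_rep_linear).

Lemma basis_mem (i : 'I_d) : b`_i \in L.
Proof. by apply/vbasis_mem/mem_nth; rewrite size_tuple. Qed.

Lemma ext_rep_coord x : x \in L ->
  ext_rep (\row_i iota (coord b i x)) = (Phi x)^iota.
Proof.
move=> xL; rewrite {2}(coord_vbasis xL) linear_sum raddf_sum.
by apply: eq_bigr => i _; rewrite linearZ /= map_mxZ mxE.
Qed.

(** The structure constants of L give the commutators. For injectivity, the
    matrices Phi b_i are linearly independent over F, and the rank of the matrix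
    that they form does not change over K. *)
Lemma ext_rep_faithful :
  faithful_rep (@lie_ext_bracket F T br K iota L) fullv ext_rep.
Proof.
have [brL Phibr Phi0] := repL.
split=> [x y _ _|u v _ _|u _]; first exact: memvf.
  rewrite /= [LHS]/ext_rep /lie_ext_bracket.
  transitivity (\sum_i \sum_j (u 0 i * v 0 j) *: (Phi (br b`_i b`_j))^iota).
    under eq_bigr => k _ do rewrite mxE scaler_suml.
    rewrite exchange_big; apply: eq_bigr => i _.
    under eq_bigr => k _ do rewrite scaler_suml.
    rewrite exchange_big; apply: eq_bigr => j _.
    rewrite -ext_rep_coord ?brL ?basis_mem // /ext_rep scaler_sumr.
    by apply: eq_bigr => k _; rewrite mxE scalerA.
  have mulE u' v' : ext_rep u' *m ext_rep v' =
      \sum_i \sum_j (u' 0 i * v' 0 j) *: (Phi b`_i *m Phi b`_j)^iota.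
    rewrite mulmx_suml; apply: eq_bigr => i _.
    rewrite mulmx_sumr; apply: eq_bigr => j _.
    by rewrite map_mxM -scalemxAl -scalemxAr scalerA.
  rewrite !mulE [X in _ - X]exchange_big -sumrB; apply: eq_bigr => i _.
  rewrite -sumrB; apply: eq_bigr => j _.
  by rewrite Phibr ?basis_mem // map_mxB scalerBr [v 0 j * _]mulrC.
pose A : 'M[F]_(d, n * n) := \matrix_i mxvec (Phi b`_i).
have Afree : row_free A.
  apply/inj_row_free => c cA.
  have xc : \sum_i c 0 i *: b`_i = 0.
    apply: Phi0; first by apply: rpred_sum => i _; rewrite rpredZ ?basis_mem.
    apply: (can_inj mxvecK); rewrite linear0 -cA mulmx_sum_row !linear_sum /=.
    by apply: eq_bigr => i _; rewrite rowK !linearZ.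
  apply/rowP => i; rewrite mxE.
  by move/freeP: (basis_free (vbasisP L)) => /(_ (c 0) xc i).
move=> u0; apply: (row_free_inj (A := A^iota)); first by rewrite row_free_map.
rewrite mul0mx -(linear0 mxvec) -u0 mulmx_sum_row linear_sum.
by apply: eq_bigr => i _; rewrite linearZ /= -map_row rowK map_mxvec.
Qed.

Lemma ext_rep_skew (G : 'M[F]_n) u : (forall x, x \in L -> skew_for G (Phi x)) ->
  skew_for G^iota (ext_rep u).
Proof.
move=> Lskew; rewrite /skew_for linear_sum mulmx_suml mulmx_sumr -sumrN.
apply: eq_bigr => i _; rewrite linearZ /= -scalemxAl -scalemxAr -scalerN.
by rewrite map_trmx -!map_mxM Lskew ?basis_mem // map_mxN.
Qed.

(** The outer square of w is a K-combination of the symmetrised elementary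
    matrices, which are defined over F. *)
Lemma ext_rep_outer (G : 'M[F]_n) (w : 'cV[K]_n) :
  (2 : F) != 0 ->
  (forall i j, exists2 x, x \in L & Phi x = (delta_mx i j + delta_mx j i) *m G) ->
  exists u, ext_rep u = w *m w^T *m G^iota.
Proof.
move=> two_neq0 Ldelta; have two_neq0K : (2 : K) != 0.
  by rewrite -(rmorph_nat iota) fmorph_eq0.
suff /memv_imgP[u _ ->] : w *m w^T *m G^iota \in limg (linfun ext_rep).
  by exists u; rewrite lfunE.
have delta_im i j :
    (delta_mx i j + delta_mx j i) *m G^iota \in limg (linfun ext_rep).
  have [x xL Ex] := Ldelta i j; apply/memv_imgP.
  exists (\row_i iota (coord b i x)); first exact: memvf.
  by rewrite lfunE /= ext_rep_coord // Ex map_mxM map_mxD !map_delta_mx.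
rewrite -[_ *m _](scalerK two_neq0K) rpredZ //.
set W := w *m w^T; have WT : W = W^T by rewrite trmx_mul trmxK.
have -> : 2 *: (W *m G^iota) =
    \sum_i \sum_j W i j *: ((delta_mx i j + delta_mx j i) *m G^iota).
  rewrite scaler_nat mulr2n -mulmxDl {2}WT {1 2}(matrix_sum_delta W).
  rewrite linear_sum -big_split mulmx_suml; apply: eq_bigr => i _ /=.
  rewrite linear_sum -big_split mulmx_suml; apply: eq_bigr => j _ /=.
  by rewrite linearZ /= trmx_delta -scalerDr scalemxAl.
by apply: rpred_sum => i _; apply: rpred_sum => j _; rewrite rpredZ.
Qed.

End ScalarExtension.

(** * Matrices of endomorphisms and of the form *)

Section MatrixOfForm.
Variables (F : fieldType) (V : vectType F) (f : {biscalar V}).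
Local Notation e := (vbasis {:V}).
Local Notation n := (\dim {:V}).

Definition gram : 'M[F]_n := \matrix_(i, j) f e`_i e`_j.
Definition coord_col (v : V) : 'cV[F]_n := (passmx.rVof e v)^T.

(** The transpose of the matrix acting on row vectors: acting on columns makes
    endo_mx multiplicative rather than antimultiplicative, so that it is a
    representation of the Lie bracket. *)
Definition endo_mx (x : 'End(V)) : 'M[F]_n := (passmx.mxof e e x)^T.

Fact endo_mx_linear : linear endo_mx.
Proof. by move=> a x y; rewrite /endo_mx passmx.mxof_linear linearP. Qed.
HB.instance Definition _ := GRing.isSemilinear.Build F _ _ _ endo_mx
  (GRing.semilinear_linear endo_mx_linear).

Let e_basis : basis_of {:V} e := vbasisP {:V}.

Lemma form_gram v w : f v w = mxform gram (coord_col v) (coord_col w).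
Proof.
rewrite {1}(coord_vbasis (memvf v)) {1}(coord_vbasis (memvf w)).
rewrite linear_sum /mxform mxE; apply: eq_bigr => j _.
rewrite linearZ /= linear_sumlz !mxE mulr_suml mulr_sumr; apply: eq_bigr => i _.
by rewrite linearZl_LR /= !mxE [RHS]mulrC.
Qed.

Lemma coord_col_surj u : exists v, coord_col v = u.
Proof.
by exists (passmx.vecof e u^T); rewrite /coord_col passmx.vecofK // trmxK.
Qed.

Lemma coord_col_app (x : 'End(V)) v : coord_col (x v) = endo_mx x *m coord_col v.
Proof. by rewrite /coord_col (passmx.rVof_app e e_basis) trmx_mul. Qed.

Lemma coord_col0 : coord_col 0 = 0.
Proof. by apply/eqP; rewrite trmx_eq0 (passmx.rVof_eq0 e_basis). Qed.

Lemma endo_mx_surj X : exists x, endo_mx x = X.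
Proof.
by exists (passmx.hommx e e X^T); rewrite /endo_mx passmx.hommxK // trmxK.
Qed.

Lemma endo_mx_inj x : endo_mx x = 0 -> x = 0.
Proof.
by move/eqP; rewrite trmx_eq0 (passmx.mxof_eq0 e_basis e_basis) => /eqP.
Qed.

Lemma endo_mx_comp x y : endo_mx (x \o y)%VF = endo_mx x *m endo_mx y.
Proof. by rewrite /endo_mx (passmx.mxof_comp e e e_basis) trmx_mul. Qed.

Lemma endo_mx1 : endo_mx \1%VF = 1%:M.
Proof. by rewrite /endo_mx passmx.mxof1 ?trmx1 // (basis_free e_basis). Qed.

Lemma mxform_inj (A B : 'M[F]_n) :
  (forall v w, mxform A (coord_col v) (coord_col w)
             = mxform B (coord_col v) (coord_col w)) -> A = B.
Proof.
move=> AB; apply/matrixP => i j; rewrite -!mxform_delta.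
have [v <-] := coord_col_surj (delta_mx i 0).
by have [w <-] := coord_col_surj (delta_mx j 0).
Qed.

Lemma mem_lie_of_form x : x \in lie_of_form f <-> skew_for gram (endo_mx x).
Proof.
split=> [/lie_of_formP fx|sx]; last first.
  by apply/lie_of_formP => v w; rewrite !form_gram !coord_col_app skew_formE.
apply: mxform_inj => v w.
by rewrite mxformN -mxform_mull -mxform_mulr -!coord_col_app -!form_gram fx.
Qed.

Lemma endo_mx_faithful :
  faithful_rep (@lfun_bracket F V) (lie_of_form f) endo_mx.
Proof.
split=> [|x y _ _|x _]; first exact: lie_of_form_bracket.
  by rewrite /lfun_bracket linearB /= !endo_mx_comp.
exact: endo_mx_inj.
Qed.

Lemma gram_unit : nondegenerate_form f -> gram \in unitmx.
Proof.
case=> f_nondeg _; rewrite -row_free_unit; apply/inj_row_free => u uG.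
have [v Ev] := coord_col_surj u^T.
have v0 : v = 0.
  by apply: f_nondeg => w; rewrite form_gram Ev /mxform trmxK uG mul0mx mxE.
by apply: trmx_inj; rewrite -Ev v0 coord_col0 !trmx0.
Qed.

Lemma gram_asymmetry sigma : is_asymmetry f sigma ->
  gram^T = gram *m endo_mx sigma.
Proof.
case=> _ f_asym; apply: mxform_inj => v w.
by rewrite -mxform_tr -mxform_mulr -coord_col_app -!form_gram.
Qed.

Lemma endo_mx_nilpotent x : nilpotent_lfun x -> exists k, endo_mx x ^+ k = 0.
Proof.
case=> k xk; exists k.
have xE v i : endo_mx x ^+ i *m coord_col v = coord_col (iter i x v).
  elim: i => [|i IHi]; first by rewrite mul1mx.
  by rewrite mx_expS -mulmxA IHi iterS coord_col_app.
apply/matrixP => i j; have [v Ev] := coord_col_surj (delta_mx j 0).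
by have /colP/(_ i) := xE v k; rewrite Ev xk coord_col0 -colE !mxE.
Qed.

Lemma cyclic_lfunE sigma k : (0 < n)%N -> endo_mx (sigma + \1%VF) ^+ k = 0 ->
  cyclic_lfun sigma <-> endo_mx (sigma + \1%VF) ^+ n.-1 != 0.
Proof.
have trX (A : 'M[F]_n) i : (A ^+ i)^T = A^T ^+ i.
  elim: i => [|i IHi]; first exact: trmx1.
  by rewrite mx_expS trmx_mul IHi -mx_expSr.
move=> n_gt0 Nk; pose A := passmx.mxof e e sigma.
have NE : endo_mx (sigma + \1%VF) = (A + 1%:M)^T.
  by rewrite linearD /= endo_mx1 [RHS]linearD /= trmx1.
have Ak : (A + 1%:M) ^+ k = 0 by apply: trmx_inj; rewrite trX -NE Nk trmx0.
by rewrite NE -trX trmx_eq0; apply: cyclic_mxE Ak.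
Qed.

(** Skewness for gram and for its transpose shows that L commutes with sigma,
    and the centraliser of a cyclic operator is commutative. *)
Lemma cyclic_lie_abelian sigma : is_asymmetry f sigma -> (0 < n)%N ->
  nilpotent_lfun (sigma + \1%VF) -> cyclic_lfun sigma -> gram \in unitmx ->
  lie_abelian (@lfun_bracket F V) (lie_of_form f).
Proof.
move=> asym n_gt0 /endo_mx_nilpotent[k Nk] cyc Gunit x y xL yL.
have GS := gram_asymmetry asym.
have [brL Phibr Phi0] := endo_mx_faithful; apply: Phi0; rewrite ?brL // Phibr //.
have comm z : z \in lie_of_form f ->
    endo_mx z *m endo_mx (sigma + \1%VF) = endo_mx (sigma + \1%VF) *m endo_mx z.
  move=> /mem_lie_of_form sz.
  have sz' := skew_for_tr sz; rewrite /skew_for in sz'.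
  rewrite linearD /= endo_mx1 mulmxDr mulmxDl mulmx1 mul1mx; congr (_ + _).
  apply: (can_inj (mulKmx Gunit)); rewrite !mulmxA -GS -[RHS]opprK -sz' GS.
  by rewrite -[X in X *m _]opprK -sz mulNmx mulmxA.
apply/eqP; rewrite subr_eq0; apply/eqP.
apply: (@cyclic_nilpotent_comm _ _ (endo_mx (sigma + \1%VF))); try exact: comm.
  move: Nk; rewrite linearD /= endo_mx1; exact: quasi_unipotent_exp.
by case: (cyclic_lfunE n_gt0 Nk) => /(_ cyc).
Qed.

End MatrixOfForm.

Theorem proposition10p8 (F : fieldType) (V : vectType F) (f : {biscalar V})
    (sigma : 'End(V)) (char_neq2 : 2%N \notin [pchar F])
    (V_neq0 : (0 < \dim {:V})%N) (f_nondeg : nondegenerate_form f)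
    (sigma_asym : is_asymmetry f sigma)
    (sigma_nilp : nilpotent_lfun (sigma + \1%VF)) :
  (lie_absolutely_reductive (@lfun_bracket F V) (lie_of_form f) <->
     cyclic_lfun sigma \/ sigma = - \1%VF) /\
  (cyclic_lfun sigma -> lie_abelian (@lfun_bracket F V) (lie_of_form f)) /\
  (sigma = - \1%VF -> skew_symmetric_form f).
Proof.
have two_neq0 : (2 : F) != 0.
  by apply: contra char_neq2 => two0; rewrite inE /= two0.
have Gunit := gram_unit f_nondeg; have GS := gram_asymmetry sigma_asym.
have repL := endo_mx_faithful f.
have [k Nk] := endo_mx_nilpotent sigma_nilp.
have cyc_abelian (cyc : cyclic_lfun sigma) :
    lie_abelian (@lfun_bracket F V) (lie_of_form f).
  exact: cyclic_lie_abelian sigma_asym V_neq0 sigma_nilp cyc Gunit.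
have skewf : sigma = - \1%VF -> skew_symmetric_form f.
  case: sigma_asym => _ f_asym sE v w.
  by rewrite f_asym sE opp_lfunE id_lfunE linearN.
split=> //; split=> [[redL _]|[cyc|sigmaE]].
- have [cycE cyc_if] := cyclic_lfunE V_neq0 Nk.
  case: (eqVneq (endo_mx (sigma + \1%VF)) 0) => [N0|N_neq0].
    by right; apply/eqP; rewrite -addr_eq0; apply/eqP/endo_mx_inj.
  case: (eqVneq (endo_mx (sigma + \1%VF) ^+ (\dim {:V}).-1) 0) => [Nn|]; last first.
    by move/cyc_if; left.
  case: (noncyclic_not_reductive two_neq0 Gunit GS repL _ _ _ _ redL).
  + by move=> x /mem_lie_of_form.
  + move=> X sX; have [x Ex] := endo_mx_surj X; exists x => //.
    by apply/mem_lie_of_form; rewrite Ex.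
  + by rewrite -endo_mx1 -linearD.
  + by rewrite -endo_mx1 -linearD.
(* Over K, the bracket of an abelian L has zero structure constants. *)
- have abL := cyc_abelian cyc; split=> [I [/subvP IL _] _ x y xL /IL yL|K iota _].
    exact: abL.
  move=> I _ _ x y _ _; apply/rowP => i; rewrite !mxE.
  rewrite big1 // => l _; rewrite big1 // => m _.
  by rewrite abL ?basis_mem // linear0 rmorph0 mulr0.
have L_skew x : x \in lie_of_form f -> skew_for (gram f) (endo_mx x).
  by move/mem_lie_of_form.
have Gskew : (gram f)^T = - gram f.
  by rewrite GS sigmaE linearN /= endo_mx1 mulmxN mulmx1.
have L_surj (Y : 'M_(\dim {:V})) : Y^T = Y ->
    exists2 x, x \in lie_of_form f & endo_mx x = Y *m gram f.
  move=> Ysym; have [x Ex] := endo_mx_surj (Y *m gram f); exists x => //.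
  apply/mem_lie_of_form.
  by rewrite Ex /skew_for trmx_mul Gskew Ysym !mulNmx mulmxA.
split=> [|K iota _].
  apply: (symplectic_reductive two_neq0 repL Gskew Gunit L_skew) => u.
  by apply: L_surj; rewrite trmx_mul trmxK.
have two_neq0K : (2 : K) != 0 by rewrite -(rmorph_nat iota) fmorph_eq0.
apply: (symplectic_reductive two_neq0K (ext_rep_faithful repL iota)
  (G := map_mx iota (gram f))).
- by rewrite map_trmx Gskew map_mxN.
- by rewrite map_unitmx.
- by move=> u _; apply: ext_rep_skew L_skew.
move=> u; have L_delta i j : exists2 x, x \in lie_of_form f &
    endo_mx x = (delta_mx i j + delta_mx j i) *m gram f.
  by apply: L_surj; rewrite linearD /= !trmx_delta addrC.
have [x Ex] := ext_rep_outer iota u two_neq0 L_delta.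
by exists x; rewrite ?memvf.
Qed.
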